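(* Let $n\ge 1$ and let $W=S^B_n$ be the Coxeter group of type $B_n$. Then for all $u,v\in W$, $$T_L(u\vee_R v)=\overline{T_L(u)\cup T_L(v)},$$ where $\vee_R$ is the join in the (right) weak order on $W$ and $\overline{A}$ denotes the Bruhat preclosure of a set of reflections $A$.
   Context: **Signed permutations.** Write $[n]=\{1,\ldots,n\}$, $[\pm n]=\{-n,\ldots,-1,1,\ldots,n\}$. $S^B_n$ is the group (under composition of maps) of bijections $\sigma:[\pm n]\to[\pm n]$ with $\sigma(-a)=-\sigma(a)$ for all $a\in[n]$. It is a Coxeter group of type $B_n$ with set of Coxeter generators $S=\{s_0,s_1,\ldots,s_{n-1}\}$, where $s_0$ exchanges $1$ and $-1$ (fixing everything else) and, for $1\le i\le n-1$, $s_i$ exchanges $i$ with $i+1$ and $-i$ with $-(i+1)$ (fixing everything else). Let $\ell$ be the Coxeter length and $e$ the identity. **Reflections.** $T=\bigcup_{w\in W}wSw^{-1}$ is the set of reflections, and the left-reflection set of $w\in W$ is $T_L(w)=\{t\in T\mid \ell(tw)<\ell(w)\}$. **Weak order.** For $u,v\in W$, $u\leq_R v$ if and only if some reduced expression for $u$ is a prefix of a reduced expression for $v$ (equivalently, $T_L(u)\subseteq T_L(v)$). Since $W$ is finite, $(W,\leq_R)$ is a lattice; $u\vee_R v$ denotes the join. **Bruhat graph and preclosure.** The Bruhat graph $B(W)$ is the directed graph with vertex set $W$ and an arrow $u\xrightarrow{t}v$ labeled by $t\in T$ whenever $v=tu$ and $\ell(u)<\ell(v)$. For $A\subseteq T$,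 an $A$-Bruhat path is a directed path in $B(W)$ starting from $e$ whose edges are all labeled by elements of $A$. The Bruhat preclosure of $A\subseteq T$ is $$\overline{A}=\{t\in T\mid \text{there is an } A\text{-Bruhat path from } e \text{ to } t\}.$$ *)

(* Defs.v *)
From HB Require Import structures.
From mathcomp Require Import all_boot all_fingroup.

Set Implicit Arguments.
Unset Strict Implicit.
Unset Printing Implicit Defensive.

Local Open Scope group_scope.

(** * Coxeter-theoretic notions for a finite group [gT] generated by [S] *)

Section Coxeter.
Variables (gT : finGroupType) (S : {set gT}).
Implicit Types (u v w t : gT) (A : {set gT}).

(* [S ^+ k] is the set of products of [k] elements of [S], so this is the least
   such [k]; when [S] generates [gT] it is always smaller than [#|gT|]. *)
Definition cox_length w : nat := find (fun k => w \in S ^+ k) (iota 0 #|gT|).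

Definition reduced_expr w (s : seq gT) : bool :=
  [&& all (mem S) s, \prod_(x <- s) x == w & size s == cox_length w].

Definition reflections : {set gT} := [set w * s * w^-1 | w in gT, s in S].

Definition left_refl w : {set gT} :=
  [set t in reflections | cox_length (t * w) < cox_length w].

(* Reduced expressions of [w] have size [cox_length w], so the quantifiers may
   range over tuples, which makes the relation decidable. *)
Definition weakR u v : bool :=
  [exists a : (cox_length u).-tuple gT, exists b : (cox_length v).-tuple gT,
     [&& reduced_expr u a, reduced_expr v b & prefix a b]].

Definition is_joinR u v w : bool :=
  [&& weakR u w, weakR v w
    & [forall z, weakR u z && weakR v z ==> weakR w z]].

(* The default value [1] is only returned if there is no join. *)
Definition joinR u v : gT := odflt 1 [pick w | is_joinR u v w].

Definition bruhat_arrow t u v : bool :=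
  [&& t \in reflections, v == t * u & cox_length u < cox_length v].

Definition bruhat_step A : rel gT :=
  fun u v => [exists t in A, bruhat_arrow t u v].

Definition bruhat_preclosure A : {set gT} :=
  [set t in reflections | connect (bruhat_step A) 1 t].

Lemma weakR_anti u v : weakR u v -> weakR v u -> u = v.
Proof.
case/existsP=> a /existsP[b /and3P[ra rb pab]].
case/existsP=> a' /existsP[b' /and3P[_ _ pab']].
have := size_prefix pab; have := size_prefix pab'; rewrite !size_tuple => h1 h2.
have e : cox_length u = cox_length v by apply/eqP; rewrite eqn_leq h1 h2.
have eab : tval a = tval b.
  move: pab; rewrite prefixE => /eqP <-.
  by rewrite take_oversize // !size_tuple e.
case/and3P: ra rb => _ /eqP pu _ /and3P[_ /eqP pv _].
by rewrite -[LHS]pu -[RHS]pv eab.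
Qed.

Lemma is_joinR_uniq u v w w' : is_joinR u v w -> is_joinR u v w' -> w = w'.
Proof.
case/and3P=> uw vw /forallP hw /and3P[uw' vw' /forallP hw'].
apply: weakR_anti; first by move/implyP: (hw w'); apply; rewrite uw' vw'.
by move/implyP: (hw' w); apply; rewrite uw vw.
Qed.

End Coxeter.

(** * Signed permutations *)

(* [{-n, .., -1, 1, .., n}]: [(false, i)] stands for the integer [i + 1] and
   [(true, i)] for [-(i + 1)]. *)
Definition pm (n : nat) : Type := (bool * 'I_n)%type.
HB.instance Definition _ n := Finite.on (pm n).

Definition pos n (i : 'I_n) : pm n := (false, i).
Definition opp n (a : pm n) : pm n := (~~ a.1, a.2).

Lemma oppK n : involutive (@opp n).
Proof. by case=> b i; rewrite /opp /= negbK. Qed.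

Definition is_signed n (w : {perm pm n}) : bool :=
  [forall i : 'I_n, w (opp (pos i)) == opp (w (pos i))].

Lemma is_signedP n (w : {perm pm n}) :
  reflect (forall a, w (opp a) = opp (w a)) (is_signed w).
Proof.
apply: (iffP forallP) => [h [b i] | h i]; last by rewrite h.
case: b; last exact: (eqP (h i)).
have /eqP := h i; rewrite /opp /pos /= => ->.
exact/esym/oppK.
Qed.

Record signed_perm (n : nat) : Type := SignedPerm {
  sp_val : {perm pm n};
  sp_valP : is_signed sp_val }.

HB.instance Definition _ n := [isSub for @sp_val n].
HB.instance Definition _ n := [Finite of signed_perm n by <:].

Definition sp_fun n (w : signed_perm n) : pm n -> pm n := sp_val w.
Coercion sp_fun : signed_perm >-> Funclass.

Lemma sp_opp n (w : signed_perm n) a : w (opp a) = opp (w a).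
Proof. exact: (is_signedP _ (sp_valP w)). Qed.

(* In [{perm _}] the product [x * y] applies [x] first, whereas the product of
   signed permutations is the composition of maps, hence the swap here. *)
Lemma sp_mul_subproof n (u v : signed_perm n) :
  is_signed (sp_val v * sp_val u).
Proof.
by apply/is_signedP=> a; rewrite !permM !(is_signedP _ (sp_valP _)).
Qed.
Definition sp_mul n (u v : signed_perm n) := SignedPerm (sp_mul_subproof u v).

Lemma sp_one_subproof n : is_signed (1 : {perm pm n}).
Proof. by apply/is_signedP=> a; rewrite !perm1. Qed.
Definition sp_one n := SignedPerm (sp_one_subproof n).

Lemma sp_inv_subproof n (u : signed_perm n) : is_signed (sp_val u)^-1.
Proof.
apply/is_signedP=> a; apply: (@perm_inj _ (sp_val u)).
by rewrite (is_signedP _ (sp_valP u)) !permKV.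
Qed.
Definition sp_inv n (u : signed_perm n) := SignedPerm (sp_inv_subproof u).

Lemma sp_mulA n : associative (@sp_mul n).
Proof. by move=> u v w; apply: val_inj; rewrite /= mulgA. Qed.
Lemma sp_mul1 n : left_id (@sp_one n) (@sp_mul n).
Proof. by move=> u; apply: val_inj; rewrite /= mulg1. Qed.
Lemma sp_mulV n : left_inverse (@sp_one n) (@sp_inv n) (@sp_mul n).
Proof. by move=> u; apply: val_inj; rewrite /= mulgV. Qed.

HB.instance Definition _ n :=
  Finite_isGroup.Build (signed_perm n) (@sp_mulA n) (@sp_mul1 n) (@sp_mulV n).

Lemma spM n (u v : signed_perm n) a : (u * v) a = u (v a).
Proof. exact: permM. Qed.

Definition pred_ord n (i : 'I_n) : 'I_n :=
  Ordinal (leq_ltn_trans (leq_pred i) (ltn_ord i)).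

(* The first case exchanges the integers [1] and [-1]; the second one exchanges
   [i] with [i + 1] and [-i] with [-(i + 1)], which are encoded by
   [pred_ord i] and [i]. *)
Definition gen_perm n (i : 'I_n) : {perm pm n} :=
  if val i == 0 then tperm (pos i) (opp (pos i))
  else tperm (pos (pred_ord i)) (pos i)
         * tperm (opp (pos (pred_ord i))) (opp (pos i)).

Lemma gen_perm_signed n (i : 'I_n) : is_signed (gen_perm i).
Proof.
apply/forallP=> j; rewrite /gen_perm; case: ifP => _; apply/eqP.
  case: (eqVneq j i) => [->|nji]; first by rewrite tpermR tpermL oppK.
  by rewrite !tpermD // /opp /pos xpair_eqE ?eqxx //= eq_sym.
rewrite !permM.
rewrite (tpermD (z := opp (pos j))) // [in RHS](tpermD (x := opp _)).
- by rewrite !permE /= /opp /pos !xpair_eqE /=; case: ifP => // _; case: ifP.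
- by case: tpermP.
- by case: tpermP.
Qed.

Definition cox_gen n (i : 'I_n) : signed_perm n :=
  SignedPerm (gen_perm_signed i).

Definition coxB n : {set signed_perm n} := [set cox_gen i | i : 'I_n].

(* Main.v *)
Require Import Defs.
From mathcomp Require Import all_boot all_fingroup zify.

Set Implicit Arguments.
Unset Strict Implicit.
Unset Printing Implicit Defensive.

Local Open Scope group_scope.

(** Write [N w] for the left-reflection set of [w] and [(a b)] for the reflection
    exchanging [a] with [b] and [-a] with [-b]; for [a < b], it belongs to [N w]
    exactly when [(a, b)] is an inversion of [w], that is, when [w^-1 b < w^-1 a].

    Join: the transitive closure [R] of the inversions of [u] and [v] is
    transitive, cotransitive and invariant under [(a, b) -> (-b, -a)].  Such a
    relation is the inversion relation of a signed permutation
    ([biclosed_inversion]), which is the join, since the weak order is the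
    inclusion of the inversion relations ([joinR_inversion]).

    The preclosure is contained in [N w], for [w] the join, because [N w] is
    Bruhat-preclosed in any Coxeter group: along a path [x -> t x] with [t] in
    [N w], the length of [w^-1 x] decreases, so that a reflection [r] at its end
    satisfies [l (w^-1 r) < l (w^-1)], that is, [r] is in [N w]
    ([bruhat_preclosure_sub]).

    Conversely, let [(a, b)] be in [R], witnessed by a chain
    [a = b0 < b1 < .. < bk = b] of inversions of [u] or [v].
    - If [b > -a], the palindrome [(b0 b1), .., (b(k-1) bk), .., (b0 b1)] labels
      a Bruhat path from [1] to [(a b)], even when the chain contains both [c]
      and [-c] for some [c] ([ascends_chain]); the case [b < -a] follows by
      symmetry.
    - If [b = -a], the step of the chain that crosses [0] yields an inversion
      [(-l, l)] of [u] or [v], and the chain after it, or the negation of the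
      chain before it, is [l = c0 < .. < cr = b] ([connectU_sign]); then [(c(r-1) cr), .., (c0 c1)],
      [(-l l)], [(c0 c1), .., (c(r-1) cr)] labels a path from [1] to [(a b)]
      ([ascends_sign]). *)

(** * Reflection cocycles *)

(** A reflection cocycle for [(gT, S)] is a map [N] from [gT] to sets satisfying
    [N (u v) = N u + u (N v) u^-1] (symmetric difference), with [N s = {s}] for
    [s] in [S], and such that every [w != 1] has a generator in [N w].  Its
    existence makes [(gT, S)] a Coxeter system with [N] the left-reflection
    sets; recall that [t ^ u] stands for [u^-1 * t * u]. *)
Record refl_cocycle (gT : finGroupType) (S : {set gT}) (N : gT -> {set gT}) :
    Prop := ReflCocycle {
  cocycleM : forall u v t, (t \in N (u * v)) = (t \in N u) (+) (t ^ u \in N v);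
  cocycleS : forall s, s \in S -> N s = [set s];
  cocycle_descent : forall w, w != 1 -> exists2 s, s \in S & s \in N w }.

Lemma conjgg (gT : finGroupType) (x : gT) : x ^ x = x.
Proof. by rewrite conjgE mulKg. Qed.

Section CocycleTheory.
Variables (gT : finGroupType) (S : {set gT}) (N : gT -> {set gT}).
Hypothesis NP : refl_cocycle S N.
Implicit Types (s t u v w x : gT) (A : {set gT}).

Notation len := (cox_length S).

Lemma cocycle1 : N 1 = set0.
Proof.
apply/setP=> t; have := cocycleM NP 1 1 t.
by rewrite mulg1 conjg1 in_set0; case: (t \in N 1).
Qed.

Lemma cocycleV w t : (t ^ w \in N w^-1) = (t \in N w).
Proof.
have := cocycleM NP w w^-1 t; rewrite mulgV cocycle1 in_set0.
by case: (t \in N w); case: (_ \in _).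
Qed.

Lemma gen_involutive s : s \in S -> s * s = 1.
Proof.
move=> sS; apply/eqP; apply/negPn/negP => /(cocycle_descent NP)[r _].
rewrite (cocycleM NP) (cocycleS NP sS) !inE.
have -> : (r ^ s == s) = (r == s).
  by rewrite -{2}[s]conjgg (inj_eq (@conjg_inj _ s)).
by case: (_ == _).
Qed.

Lemma gen_inv s : s \in S -> s^-1 = s.
Proof. by move=> sS; apply: (mulgI s); rewrite mulgV gen_involutive. Qed.

Lemma cocycle_genM s w t :
  s \in S -> (t \in N (s * w)) = (t == s) (+) (t ^ s \in N w).
Proof. by move=> sS; rewrite (cocycleM NP) (cocycleS NP sS) inE. Qed.

Lemma card_cocycle_genM_le s w : s \in S -> #|N (s * w)| <= #|N w|.+1.
Proof.
move=> sS; rewrite -(cardJg (N w) s) -add1n -(cards1 s).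
apply: leq_trans (leq_card_setU _ _); apply/subset_leq_card/subsetP => t.
rewrite (cocycle_genM _ _ sS) !inE mem_conjg gen_inv //.
by case: (_ == _); case: (_ \in _).
Qed.

Lemma card_cocycle_descent s w :
  s \in S -> s \in N w -> #|N (s * w)|.+1 = #|N w|.
Proof.
move=> sS sN; rewrite -(cardJg (N w) s) (cardsD1 s (N w :^ s)).
rewrite mem_conjg gen_inv // conjgg sN add1n; congr _.+1; apply: eq_card => t.
rewrite (cocycle_genM _ _ sS) !inE mem_conjg gen_inv //.
by have [->|] := eqVneq t s; rewrite ?conjgg ?sN.
Qed.

Lemma card_cocycle_expg w k : w \in S ^+ k -> #|N w| <= k.
Proof.
elim: k w => [|k IH] w.
  by rewrite expg0 => /set1P->; rewrite cocycle1 cards0.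
rewrite expgS => /mulsgP[s x sS xS ->].
by apply: leq_trans (card_cocycle_genM_le _ sS) _; rewrite ltnS IH.
Qed.

Lemma mem_expg_card_cocycle w : w \in S ^+ #|N w|.
Proof.
move: {2}#|N w| (erefl #|N w|) => k; elim: k w => [|k IH] w Ek.
  rewrite Ek expg0 inE; apply/negPn/negP => /(cocycle_descent NP)[s _ sN].
  by move/cards0_eq: Ek sN => ->; rewrite in_set0.
have w1 : w != 1 by apply/eqP => E; rewrite E cocycle1 cards0 in Ek.
have [s sS sN] := cocycle_descent NP w1.
have E := card_cocycle_descent sS sN; rewrite Ek in E; case: E => E.
rewrite Ek expgS -[w](mulKg s) gen_inv //; apply: mem_mulg => //.
by rewrite -E; apply: IH.
Qed.

(** Induction on elements along generators [s] with [len (s * w) > len w]. *)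
Lemma cocycle_ind (P : gT -> Prop) :
  P 1 -> (forall s w, s \in S -> s \notin N w -> #|N (s * w)| = #|N w|.+1 ->
            P w -> P (s * w)) ->
  forall w, P w.
Proof.
move=> P1 PM w; move: {2}#|N w| (erefl #|N w|) => k; elim: k w => [|k IH] w Ek.
  suff -> : w = 1 by [].
  by have := mem_expg_card_cocycle w; rewrite Ek expg0 => /set1P.
have w1 : w != 1 by apply/eqP => E; rewrite E cocycle1 cards0 in Ek.
have [s sS sN] := cocycle_descent NP w1.
have E := card_cocycle_descent sS sN.
rewrite -[w](mulKg s) gen_inv //; apply: PM => //.
- by rewrite (cocycle_genM _ _ sS) eqxx conjgg sN.
- by rewrite mulgA gen_involutive // mul1g.
- by apply: IH; move: E; rewrite Ek => -[].
Qed.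

Lemma reflectionsJ t w : t \in reflections S -> t ^ w \in reflections S.
Proof.
case/imset2P => u s _ sS ->; apply/imset2P; exists (w^-1 * u) s => //.
by rewrite conjgE invMg invgK !mulgA.
Qed.

Lemma cocycle_sub_reflections w : N w \subset reflections S.
Proof.
elim/cocycle_ind: w => [|s w sS _ _ IH]; first by rewrite cocycle1 sub0set.
apply/subsetP=> t; rewrite (cocycle_genM _ _ sS).
have [-> _|_ /= tN] := eqVneq t s.
  by apply/imset2P; exists 1 s; rewrite ?mul1g ?invg1 ?mulg1.
by rewrite -[t](conjgK s) reflectionsJ // (subsetP IH).
Qed.

Lemma reflection_inv t : t \in reflections S -> t^-1 = t.
Proof. by case/imset2P => u s _ sS ->; rewrite !invMg invgK gen_inv // mulgA. Qed.

Lemma reflection_self t : t \in reflections S -> t \in N t.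
Proof.
case/imset2P => u s _ sS ->; set t' := u * s * u^-1.
have tE : t' = s ^ u^-1 by rewrite conjgE invgK mulgA.
have Eu : t' ^ u = s by rewrite tE conjgKV.
have Eus : t' ^ (u * s) = s by rewrite conjgM Eu conjgg.
rewrite {2}/t' (cocycleM NP) (cocycleM NP) Eus (cocycleS NP sS) Eu set11.
by rewrite -Eu cocycleV; case: (_ \in _).
Qed.

Lemma cox_length_cocycle w : len w = #|N w|.
Proof.
have lt : #|N w| < #|gT|.
  rewrite -cardsT; apply/proper_card/properP; split; first exact: subsetT.
  exists 1; rewrite ?inE //; apply/negP => /(subsetP (cocycle_sub_reflections w)).
  by move/reflection_self; rewrite cocycle1 in_set0.
rewrite /cox_length; set a := fun k => _.
have ha : has a (iota 0 #|gT|).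
  apply/hasP; exists #|N w|; rewrite ?mem_iota //.
  exact: mem_expg_card_cocycle.
have fl : find a (iota 0 #|gT|) < #|gT| by rewrite has_find size_iota in ha.
apply/eqP; rewrite eqn_leq; apply/andP; split.
  rewrite leqNgt; apply/negP => /(before_find 0); rewrite nth_iota // add0n /a.
  by rewrite mem_expg_card_cocycle.
by have := nth_find 0 ha; rewrite nth_iota // add0n; apply: card_cocycle_expg.
Qed.

Lemma cox_length1 : len 1 = 0.
Proof. by rewrite cox_length_cocycle cocycle1 cards0. Qed.

Lemma cox_length_gen s w : s \in S -> len (s * w) <= (len w).+1.
Proof. by rewrite !cox_length_cocycle; apply: card_cocycle_genM_le. Qed.

Lemma cocycle_lt t w : t \in N w -> len (t * w) < len w.
Proof.
elim/cocycle_ind: w t => [|s w sS sN E IH] t; first by rewrite cocycle1 in_set0.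
have El : len (s * w) = (len w).+1 by rewrite !cox_length_cocycle.
rewrite (cocycle_genM _ _ sS); have [-> _|_ /= tN] := eqVneq t s.
  by rewrite El mulgA gen_involutive // mul1g.
rewrite El (_ : t * (s * w) = s * (t ^ s * w)); last first.
  by rewrite conjgE !mulgA mulgV mul1g.
by apply: leq_ltn_trans (cox_length_gen _ sS) _; rewrite ltnS; apply: IH.
Qed.

Lemma cocycle_reflM t w :
  t \in reflections S -> (t \in N (t * w)) = (t \notin N w).
Proof. by move=> tT; rewrite (cocycleM NP) conjgg reflection_self. Qed.

Lemma cocycle_gt t w :
  t \in reflections S -> t \notin N w -> len w < len (t * w).
Proof.
move=> tT tN; have := tN; rewrite -cocycle_reflM // => /cocycle_lt.
by rewrite mulgA -{1}(reflection_inv tT) mulVg mul1g.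
Qed.

Lemma left_refl_cocycle w : left_refl S w = N w.
Proof.
apply/setP=> t; rewrite inE; apply/andP/idP => [[tT]|tN].
  by apply: contraTT => tN; rewrite -leqNgt ltnW // cocycle_gt.
by rewrite (subsetP (cocycle_sub_reflections w)) // cocycle_lt.
Qed.

Lemma reduced_expr_exists w : exists s : seq gT, reduced_expr S w s.
Proof.
elim/cocycle_ind: w => [|s w sS _ E [r /and3P[rS /eqP rw /eqP rl]]].
  by exists [::]; rewrite /reduced_expr big_nil cox_length1 !eqxx.
exists (s :: r); apply/and3P; split; first by rewrite /= sS.
  by rewrite big_cons rw.
by rewrite /= rl !cox_length_cocycle E.
Qed.

Lemma cox_length_prod (s : seq gT) :
  all (mem S) s -> len (\prod_(x <- s) x) <= size s.
Proof.
elim: s => [|x s IH] /=; first by rewrite big_nil cox_length1.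
case/andP=> xS /IH h; rewrite big_cons.
by apply: leq_trans (cox_length_gen _ xS) _; rewrite ltnS.
Qed.

Lemma weakR_cocycle u v : weakR S u v = (N u \subset N v).
Proof.
apply/idP/subsetP => [|sub].
  case/existsP=> a /existsP[b /and3P[/and3P[_ /eqP au _] /and3P[bS /eqP bv _] ]].
  case/prefixP => c bE; set x := \prod_(y <- c) y.
  have vE : v = u * x by rewrite -bv bE big_cat au.
  have lx : len u + len x <= len v.
    have := size_tuple b; rewrite bE size_cat size_tuple => <-.
    rewrite leq_add2l cox_length_prod //.
    by move: bS; rewrite bE all_cat => /andP[].
  (* [N v] is the symmetric difference of two sets whose cardinals add up to at
     most its own, hence these sets are disjoint *)
  move: lx; rewrite !cox_length_cocycle -(cardJg (N x) u^-1) vE.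
  have <- : (N u :\: N x :^ u^-1) :|: (N x :^ u^-1 :\: N u) = N (u * x).
    apply/setP=> t; rewrite (cocycleM NP) !inE mem_conjg invgK.
    by case: (_ \in _); case: (_ \in _).
  set B := N x :^ u^-1 => h t tu; rewrite !inE tu andbT; apply/orP; left.
  have /eqP/cards0_eq Z : #|N u :&: B| == 0.
    have := leq_trans h (leq_card_setU _ _).
    rewrite -(cardsID B (N u)) -[#|B|](cardsID (N u) B) [B :&: _]setIC.
    by move: #|_ :&: _| #|N u :\: B| #|B :\: _| => i j k; lia.
  apply/negP => tB; have : t \in N u :&: B by rewrite inE tu.
  by rewrite Z inE.
have [r ru] := reduced_expr_exists u.
have [q qx] := reduced_expr_exists (u^-1 * v).
have lv : len v = len u + len (u^-1 * v).
  rewrite !cox_length_cocycle -(cardJg (N (u^-1 * v)) u^-1).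
  rewrite -[v in LHS](mulKVg u).
  rewrite (_ : N (u * (u^-1 * v)) = N u :|: N (u^-1 * v) :^ u^-1).
    rewrite cardsU (_ : _ :&: _ = set0) ?cards0 ?subn0 //.
    apply/setP=> t; rewrite in_set0; apply/negP; rewrite inE => /andP[tu].
    by rewrite mem_conjg invgK (cocycleM NP) conjgK cocycleV tu sub.
  apply/setP=> t; rewrite (cocycleM NP) !inE mem_conjg invgK (cocycleM NP).
  rewrite conjgK cocycleV; have := sub t.
  by case: (_ \in _) => [->|_] //=; case: (_ \in _).
case/and3P: ru => rS /eqP ru rl; case/and3P: qx => qS /eqP qx ql.
have sl : size (r ++ q) == len v by rewrite size_cat (eqP rl) (eqP ql) lv.
apply/existsP; exists (Tuple rl); apply/existsP; exists (Tuple sl).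
rewrite /reduced_expr /= rS ru rl all_cat rS qS big_cat /= ru qx mulKVg !eqxx sl.
exact: prefix_prefix.
Qed.

(** Left-reflection sets are closed under the Bruhat preclosure: along a path
    with labels in [N w], the length of [w^-1 * x] strictly decreases. *)
Lemma bruhat_preclosure_sub A w :
  A \subset N w -> bruhat_preclosure S A \subset N w.
Proof.
move=> sub; apply/subsetP=> t; rewrite inE => /andP[tT ct].
have step x y : bruhat_step S A x y -> len (w^-1 * y) < len (w^-1 * x).
  case/existsP=> r /andP[rA /and3P[rT /eqP -> lt]].
  have rx : r \notin N x.
    by apply/negP => /cocycle_lt; rewrite ltnNge ltnW.
  rewrite (_ : w^-1 * (r * x) = r ^ w * (w^-1 * x)); last first.
    by rewrite conjgE -!mulgA mulKVg.
  apply: cocycle_lt; rewrite (cocycleM NP) conjgK cocycleV.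
  by rewrite (subsetP sub) // (negPf rx).
apply/negPn/negP => tw.
have le : len (w^-1 * t) <= len (w^-1 * 1).
  case/connectP: ct => p + ->; move: {1 2 3}1.
  elim: p => //= y p IH x /andP[xy /IH].
  by move/leq_trans; apply; apply/ltnW/step.
have : len (w^-1) < len (t ^ w * w^-1).
  by apply: cocycle_gt; rewrite ?reflectionsJ // cocycleV.
by rewrite conjgE -!mulgA mulgV mulg1 ltnNge; move: le; rewrite mulg1 => ->.
Qed.

Lemma bruhat_step_reflM A t x :
  A \subset reflections S -> t \in A -> t \notin N x -> bruhat_step S A x (t * x).
Proof.
move=> sub tA tx; apply/existsP; exists t; rewrite tA /bruhat_arrow eqxx.
by rewrite (subsetP sub) // cocycle_gt // (subsetP sub).
Qed.

End CocycleTheory.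

(** * Reflections and inversions of signed permutations *)

Section SignedPerm.
Variable n : nat.
Implicit Types (a b c d : pm n) (t u v w x y : signed_perm n).

Lemma sp_ext u v : (forall a, u a = v a) -> u = v.
Proof. by move=> E; apply/val_inj/permP. Qed.

Lemma sp1 a : (1 : signed_perm n) a = a.
Proof. exact: perm1. Qed.

Lemma spK w : cancel w w^-1.
Proof. by move=> a; rewrite -spM mulVg sp1. Qed.

Lemma spKV w : cancel w^-1 w.
Proof. by move=> a; rewrite -spM mulgV sp1. Qed.

Lemma sp_inj w : injective w.
Proof. exact: can_inj (spK w). Qed.

(** The position of [a] in the increasing enumeration of [{-n, .., n} \ {0}],
    counted from [0]; it is used to compare elements of [pm n]. *)
Definition rk a : nat := if a.1 then n.-1 - a.2 else n + a.2.

Lemma rkE a b : (a == b) = (rk a == rk b).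
Proof.
case: a b => [[] i] [[] j]; rewrite xpair_eqE /rk -(inj_eq val_inj) /=;
  have := ltn_ord i; have := ltn_ord j; lia.
Qed.

Lemma rk_inj : injective rk.
Proof. by move=> a b E; apply/eqP; rewrite rkE E. Qed.

Lemma rk_opp a : rk (opp a) = (2 * n).-1 - rk a.
Proof. by case: a => [[] i]; rewrite /rk /=; have := ltn_ord i; lia. Qed.

Lemma rk_lt a : rk a < 2 * n.
Proof. by case: a => [[] i]; rewrite /rk /=; have := ltn_ord i; lia. Qed.

Lemma rk_surj k : k < 2 * n -> exists a, rk a = k.
Proof.
move=> lt; have [kn|nk] := ltnP k n.
  have h : n.-1 - k < n by lia.
  by exists (true, Ordinal h); rewrite /rk /=; lia.
have h : k - n < n by lia.
by exists (false, Ordinal h); rewrite /rk /=; lia.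
Qed.

(** The map exchanging [a] with [b] and [-a] with [-b]. *)
Definition refl_fun a b c : pm n :=
  if c == a then b else if c == b then a else
  if c == opp a then opp b else if c == opp b then opp a else c.

Lemma refl_funK a b : involutive (refl_fun a b).
Proof.
move=> c; apply: rk_inj; rewrite /refl_fun !rkE.
have := rk_lt a; have := rk_lt b; have := rk_lt c.
by do ![case: ifP]; rewrite ?rk_opp; lia.
Qed.

Lemma refl_fun_opp a b c : refl_fun a b (opp c) = opp (refl_fun a b c).
Proof.
apply: rk_inj; rewrite /refl_fun !rkE.
have := rk_lt a; have := rk_lt b; have := rk_lt c.
by do ![case: ifP]; rewrite ?rk_opp; lia.
Qed.

Lemma refl_signed a b : is_signed (perm (can_inj (refl_funK a b))).
Proof. by apply/is_signedP=> c; rewrite !permE refl_fun_opp. Qed.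

(** The reflection [(a b) (-a -b)], which for [b = -a] is [(a -a)]. *)
Definition refl a b : signed_perm n := SignedPerm (refl_signed a b).

Lemma reflE a b c : refl a b c = refl_fun a b c.
Proof. exact: permE. Qed.

Lemma refl_mulgg a b : refl a b * refl a b = 1.
Proof. by apply: sp_ext => c; rewrite spM !reflE refl_funK sp1. Qed.

Lemma refl_inv a b : (refl a b)^-1 = refl a b.
Proof. by apply: (mulgI (refl a b)); rewrite mulgV refl_mulgg. Qed.

Lemma reflL a b : refl a b a = b.
Proof. by rewrite reflE /refl_fun eqxx. Qed.

Lemma reflR a b : refl a b b = a.
Proof. by rewrite -{2}(reflL a b) -spM refl_mulgg sp1. Qed.

Lemma refl_out a b c :
  rk c != rk a -> rk c != rk b -> rk c != rk (opp a) -> rk c != rk (opp b) ->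
  refl a b c = c.
Proof. by rewrite reflE /refl_fun !rkE => /negPf-> /negPf-> /negPf-> /negPf->. Qed.

Lemma refl_sym a b : refl a b = refl b a.
Proof.
apply: sp_ext => c; apply: rk_inj; rewrite !reflE /refl_fun !rkE.
have := rk_lt a; have := rk_lt b; have := rk_lt c.
by do ![case: ifP]; rewrite ?rk_opp; lia.
Qed.

Lemma refl_opp a b : refl (opp b) (opp a) = refl a b.
Proof.
apply: sp_ext => c; apply: rk_inj; rewrite !reflE /refl_fun !rkE.
have := rk_lt a; have := rk_lt b; have := rk_lt c.
by do ![case: ifP]; rewrite ?rk_opp; lia.
Qed.

Lemma refl_conj w a b : refl (w a) (w b) = refl a b ^ w^-1.
Proof.
apply: sp_ext => c; rewrite conjgE invgK !spM !reflE.
rewrite -{1}(spKV w c) /refl_fun -!sp_opp !(inj_eq (@sp_inj w)).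
by do ![case: ifP => _].
Qed.

Lemma refl_conjM a b c d : refl a b * refl c d * refl a b =
  refl (refl a b c) (refl a b d).
Proof. by rewrite refl_conj conjgE invgK refl_inv mulgA. Qed.

Lemma refl_eq a b c d :
  rk a < rk b -> rk c < rk d -> refl a b = refl c d ->
  a = c /\ b = d \/ a = opp d /\ b = opp c.
Proof.
move=> + cd E; rewrite -(reflL a b) E reflE /refl_fun.
case: eqP => [-> _|_]; first by left.
case: eqP => [-> lt|_]; first by lia.
case: eqP => [-> |_].
  by rewrite !rk_opp; have := rk_lt c; lia.
by case: eqP => [-> _|_]; [right | rewrite ltnn].
Qed.

(** The pairs [a < b] whose order is reversed by [w^-1]. *)
Definition inversion w : rel (pm n) :=
  fun a b => (rk a < rk b) && (rk (w^-1 b) < rk (w^-1 a)).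

(** The reflections given by the inversions of [w]; this is a reflection cocycle,
    hence the left-reflection set of [w]. *)
Definition inv_refl w : {set signed_perm n} :=
  [set refl p.1 p.2 | p in [pred p : pm n * pm n | inversion w p.1 p.2]].

Lemma inversion_opp w a b : inversion w (opp b) (opp a) = inversion w a b.
Proof.
rewrite /inversion !sp_opp !rk_opp.
have := rk_lt a; have := rk_lt b.
by have := rk_lt (w^-1 a); have := rk_lt (w^-1 b); lia.
Qed.

Lemma inv_reflP w t :
  reflect (exists2 p : pm n * pm n, inversion w p.1 p.2 & t = refl p.1 p.2)
          (t \in inv_refl w).
Proof. by apply: (iffP imsetP) => -[p pw ->]; exists p. Qed.

Lemma mem_inv_refl w a b :
  rk a < rk b -> (refl a b \in inv_refl w) = (rk (w^-1 b) < rk (w^-1 a)).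
Proof.
move=> ab; apply/inv_reflP/idP => [[[c d] /= cdw E]|h]; last first.
  by exists (a, b); rewrite // /inversion ab.
have cd : rk c < rk d by case/andP: cdw.
have [[-> ->]|[-> ->]] := refl_eq ab cd E.
  by case/andP: cdw.
by move: cdw; rewrite -inversion_opp => /andP[].
Qed.

Lemma inv_reflM_refl u v a b : rk a < rk b ->
  (refl a b \in inv_refl (u * v)) =
  (refl a b \in inv_refl u) (+) (refl a b ^ u \in inv_refl v).
Proof.
move=> ab.
have -> : refl a b ^ u = refl (u^-1 a) (u^-1 b) by rewrite refl_conj invgK.
rewrite !(mem_inv_refl _ ab) invMg !spM.
have neq : rk (u^-1 a) != rk (u^-1 b).
  by rewrite -rkE (inj_eq (@sp_inj _)) rkE; lia.
have neqv : rk (v^-1 (u^-1 a)) != rk (v^-1 (u^-1 b)).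
  by rewrite -rkE (inj_eq (@sp_inj _)) rkE.
have [lt|le] := ltnP (rk (u^-1 b)) (rk (u^-1 a)).
  by rewrite refl_sym mem_inv_refl //= -leqNgt [LHS]ltn_neqAle eq_sym neqv.
by rewrite mem_inv_refl // ltn_neqAle neq.
Qed.

Lemma inv_reflM u v t :
  (t \in inv_refl (u * v)) = (t \in inv_refl u) (+) (t ^ u \in inv_refl v).
Proof.
have [/existsP[[a b] /= /andP[ab /eqP->]]|/existsP no] :=
  boolP [exists p : pm n * pm n, (rk p.1 < rk p.2) && (t == refl p.1 p.2)].
  exact: inv_reflM_refl.
have notin w : (t \in inv_refl w) = false.
  apply/negP => /inv_reflP[p /andP[lt _] E]; apply: no; exists p.
  by rewrite lt E eqxx.
rewrite !notin; apply/esym/negbTE/negP => /inv_reflP[[a b] /= /andP[ab _] E].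
have {}E : t = refl (u a) (u b) by rewrite refl_conj -E conjgK.
have neq : rk (u a) != rk (u b) by rewrite -rkE (inj_eq (@sp_inj _)) rkE; lia.
apply: no; case: (ltnP (rk (u a)) (rk (u b))) => h.
  by exists (u a, u b); rewrite /= h E eqxx.
by exists (u b, u a); rewrite /= refl_sym -E eqxx andbT; lia.
Qed.

Lemma coxBP t :
  reflect (exists2 p : pm n * pm n, rk p.2 = (rk p.1).+1 & t = refl p.1 p.2)
          (t \in coxB n).
Proof.
have gen0 (i : 'I_n) : val i = 0 -> cox_gen i = refl (opp (pos i)) (pos i).
  move=> i0; apply: sp_ext => a; rewrite reflE /sp_fun /= /gen_perm i0 /=.
  apply: rk_inj; rewrite permE /= /refl_fun !rkE !rk_opp.
  have := rk_lt a; have := rk_lt (pos i).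
  by do ![case: ifP]; rewrite ?rk_opp; lia.
have genS (i : 'I_n) :
    val i != 0 -> cox_gen i = refl (pos (pred_ord i)) (pos i).
  move=> i0; apply: sp_ext => a.
  rewrite reflE /sp_fun /= /gen_perm (negPf i0) permM !permE /=.
  apply: rk_inj; rewrite /refl_fun !rkE.
  have := rk_lt a; have := rk_lt (pos i); have := rk_lt (pos (pred_ord i)).
  have : n <= rk (pos i) by rewrite /rk /=; lia.
  have : n <= rk (pos (pred_ord i)) by rewrite /rk /=; lia.
  have : rk (pos i) != rk (pos (pred_ord i)) by move: i0; rewrite /rk /=; lia.
  by do ![case: ifP]; rewrite ?rk_opp; lia.
apply: (iffP imsetP) => [[i _ ->]|[[a b] /= ab ->]].
  have [i0|i0] := eqVneq (val i) 0.
    exists (opp (pos i), pos i); rewrite ?gen0 //= rk_opp /rk /=.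
    by move: i0 (ltn_ord i) => /=; lia.
  exists (pos (pred_ord i), pos i); rewrite ?genS //.
  by move: i0; rewrite /rk /=; lia.
case: a b ab => [[] i] [[] j]; rewrite /rk /=;
  have := ltn_ord i; have := ltn_ord j => hi hj ij.
- exists i => //; have -> : (true, j) = opp (pos (pred_ord i)).
    by congr (_, _); apply: val_inj => /=; lia.
  have i0 : val i != 0 by move=> /=; lia.
  by rewrite genS //; apply: (refl_opp (pos (pred_ord i)) (pos i)).
- exists j => //; have -> : i = j by apply: val_inj => /=; lia.
  by rewrite gen0 //=; lia.
- by lia.
exists j => //; have -> : i = pred_ord j by apply: val_inj => /=; lia.
by rewrite genS //=; lia.
Qed.

Lemma inv_refl_gen s : s \in coxB n -> inv_refl s = [set s].
Proof.
case/coxBP => -[c d] /= cd ->; apply/setP=> t; rewrite inE.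
apply/inv_reflP/eqP => [[[a b] /= /andP[ab ba] ->]|->]; last first.
  by exists (c, d); rewrite //= /inversion refl_inv reflL reflR cd ltnSn.
suff [[-> ->]|[-> ->]] : a = c /\ b = d \/ a = opp d /\ b = opp c.
- by [].
- exact: refl_opp.
have : (rk a == rk c) && (rk b == rk d)
    || (rk a == rk (opp d)) && (rk b == rk (opp c)).
  move: ba; rewrite refl_inv !reflE /refl_fun !rkE !rk_opp.
  have := rk_lt a; have := rk_lt b; have := rk_lt c; have := rk_lt d.
  by do ![case: ifP]; rewrite ?rk_opp; lia.
by rewrite -!rkE => /orP[] /andP[/eqP-> /eqP->]; [left|right].
Qed.

Lemma inv_refl_descent w :
  w != 1 -> exists2 s, s \in coxB n & s \in inv_refl w.
Proof.
move=> w1; apply/exists_inP; apply: contraNT w1 => /exists_inPn no.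
(* without adjacent descents, [w^-1] is increasing *)
have up k a : rk a = k -> k <= rk (w^-1 a).
  elim: k a => // k IH b bk.
  have [a ak] : exists a, rk a = k by apply: rk_surj; have := rk_lt b; lia.
  have ab : rk b = (rk a).+1 by rewrite ak.
  have := no (refl a b); rewrite mem_inv_refl ?ab // => h.
  have {h} : ~~ (rk (w^-1 b) < rk (w^-1 a)).
    by apply: h; apply/coxBP; exists (a, b).
  have : rk (w^-1 a) != rk (w^-1 b).
    by rewrite -rkE (inj_eq (@sp_inj _)) rkE ab; lia.
  by have := IH a ak; lia.
apply/eqP; rewrite -[w]invgK -[RHS]invg1; congr _^-1; apply: sp_ext => a.
rewrite sp1; apply: rk_inj; move: (up _ (opp a) erefl) (up _ a erefl).
rewrite sp_opp !rk_opp; move: (w^-1 a) (rk_lt (w^-1 a)) (rk_lt a) => b; lia.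
Qed.

Lemma coxB_cocycle : refl_cocycle (coxB n) inv_refl.
Proof.
split; [exact: inv_reflM | exact: inv_refl_gen | exact: inv_refl_descent].
Qed.

Lemma mem_inv_refl_inversion w a b :
  rk a < rk b -> (refl a b \in inv_refl w) = inversion w a b.
Proof. by move=> ab; rewrite mem_inv_refl // /inversion ab. Qed.

End SignedPerm.

(** * Inversion sets and joins *)

Section Join.
Variable n : nat.
Implicit Types (a b c d : pm n) (t u v w x y z : signed_perm n).

Lemma inversion_transitive w : transitive (inversion w).
Proof. by move=> b a c; rewrite /inversion; lia. Qed.

Lemma inv_refl_sub u v :
  reflect (subrel (inversion u) (inversion v)) (inv_refl u \subset inv_refl v).
Proof.
apply: (iffP subsetP) => [sub a b uab|sub t].
  have ab : rk a < rk b by case/andP: uab.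
  by rewrite -mem_inv_refl_inversion // sub // mem_inv_refl_inversion.
by case/inv_reflP=> p /sub pv ->; apply/inv_reflP; exists p.
Qed.

(** A relation contained in the order of [pm n], transitive, cotransitive and
    invariant under negation is the inversion relation of a signed permutation:
    a [w] with as many inversions as possible among those with inversions in [R]
    has them all, since otherwise some [(a, b)] in [R] that is not an inversion
    has [w^-1 a] and [w^-1 b] adjacent, and it can be added. *)
Lemma biclosed_inversion (R : rel (pm n)) :
    (forall a b, R a b -> rk a < rk b) -> transitive R ->
    (forall a b c, rk a < rk c -> rk c < rk b -> R a b -> R a c || R c b) ->
    (forall a b, R a b -> R (opp b) (opp a)) ->
  exists w, inversion w =2 R.
Proof.
move=> Rlt Rtr Rco Ropp.
pose P w := [forall a, forall b, inversion w a b ==> R a b].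
have P1 : P 1.
  by apply/'forall_forallP => a b; rewrite /inversion invg1 !sp1; lia.
case: (arg_maxnP (fun w => #|inv_refl w|) P1) => w Pw wmax.
have wR a b : inversion w a b -> R a b.
  by move/'forall_forallP: Pw => /(_ a b)/implyP.
exists w => a b; apply/idP/idP; first exact: wR.
have [k] := ubnP (rk (w^-1 b) - rk (w^-1 a)).
elim: k a b => // k IH a b lek Rab.
have ab := Rlt _ _ Rab; rewrite /inversion ab /=.
have [//|le] := ltnP (rk (w^-1 b)) (rk (w^-1 a)).
have neq : rk (w^-1 a) != rk (w^-1 b).
  by rewrite -rkE (inj_eq (@sp_inj _ _)) rkE; lia.
have {le neq} lt : rk (w^-1 a) < rk (w^-1 b) by rewrite ltn_neqAle neq.
have noninv c d :
    R c d -> rk (w^-1 a) <= rk (w^-1 c) -> rk (w^-1 d) <= rk (w^-1 b) ->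
    rk (w^-1 a) < rk (w^-1 c) \/ rk (w^-1 d) < rk (w^-1 b) ->
    rk (w^-1 d) < rk (w^-1 c).
  move=> Rcd h1 h2 h3; have [//|le] := ltnP (rk (w^-1 d)) (rk (w^-1 c)).
  have /andP[_] : inversion w c d by apply: IH => //; lia.
  by rewrite ltnNge le.
(* a [c] placed between [a] and [b] by [w^-1] gives a pair in [R], involving [c]
   and closer in position, that is not an inversion; induction excludes it *)
have [adj|nadj] := eqVneq (rk (w^-1 b)) (rk (w^-1 a)).+1; last first.
  have [c' c'k] : exists c', rk c' = (rk (w^-1 a)).+1.
    by apply: rk_surj; have := rk_lt (w^-1 b); lia.
  pose c := w c'; have wc : w^-1 c = c' by apply: spK.
  rewrite -{}wc in c'k.
  have [ca|ac|E] := ltngtP (rk c) (rk a); last by rewrite (rk_inj E) in c'k; lia.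
    have Rca : R c a by apply: wR; rewrite /inversion ca; lia.
    by have := noninv _ _ (Rtr _ _ _ Rca Rab); lia.
  have [cb|bc|E] := ltngtP (rk c) (rk b); last by rewrite (rk_inj E) in c'k; lia.
    have /orP[Rac|Rcb] := Rco _ _ _ ac cb Rab.
      by have := noninv _ _ Rac; lia.
    by have := noninv _ _ Rcb; lia.
  have Rbc : R b c by apply: wR; rewrite /inversion bc; lia.
  by have := noninv _ _ (Rtr _ _ _ Rab Rbc); lia.
(* [w * s] has the inversions of [w], [(a, b)] and [(-b, -a)] *)
pose s := refl (w^-1 a) (w^-1 b).
have sS : s \in coxB n by apply/coxBP; exists (w^-1 a, w^-1 b).
have sE : s = refl a b ^ w by rewrite /s refl_conj invgK.
have ws t : (t \in inv_refl (w * s)) = (t \in inv_refl w) (+) (t == refl a b).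
  by rewrite inv_reflM (inv_refl_gen sS) inE sE (inj_eq (conjg_inj w)).
have nab : refl a b \notin inv_refl w by rewrite mem_inv_refl // -leqNgt ltnW.
have /wmax : P (w * s).
  apply/'forall_forallP => c d; apply/implyP => cd.
  have ltcd : rk c < rk d by case/andP: cd.
  move: cd; rewrite -mem_inv_refl_inversion // ws.
  have [E _|_] := eqVneq (refl c d) (refl a b); last first.
    by rewrite addbF mem_inv_refl_inversion //; apply: wR.
  have [[-> ->] //|[-> ->]] := refl_eq ltcd ab E.
  exact: Ropp.
rewrite /= leqNgt => /negP[]; apply: proper_card; apply/properP; split.
  apply/subsetP => t tw; rewrite ws tw; apply: contraNneq nab => <-; exact: tw.
by exists (refl a b); rewrite // ws eqxx addbT.
Qed.

Section UnionClosure.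
Variables u v : signed_perm n.

(** The inversions of [u] or [v]. *)
Definition inversionU : rel (pm n) :=
  fun a b => inversion u a b || inversion v a b.

(** Their transitive closure; [inversionU] being irreflexive and acyclic, only the
    diagonal is to be removed from [connect inversionU]. *)
Definition inversionU_closure : rel (pm n) :=
  fun a b => (a != b) && connect inversionU a b.

Local Notation I := inversionU.
Local Notation R := inversionU_closure.

Lemma inversionU_lt a b : I a b -> rk a < rk b.
Proof. by case/orP => /andP[]. Qed.

Lemma inversionU_opp a b : I a b -> I (opp b) (opp a).
Proof. by rewrite /I !inversion_opp. Qed.

Lemma pathU_lt a p c : path I a p -> c \in p -> rk a < rk c.
Proof.
elim: p a => //= d p IH a /andP[/inversionU_lt ad /IH h]; rewrite inE.
by case/orP => [/eqP->//|/h]; apply: ltn_trans.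
Qed.

Lemma connectU_le a b : connect I a b -> rk a <= rk b.
Proof.
case/connectP=> p + ->; elim: p a => //= c p IH a /andP[/inversionU_lt ac /IH].
exact/leq_trans/ltnW.
Qed.

Lemma connectU_opp a b : connect I a b -> connect I (opp b) (opp a).
Proof.
case/connectP=> p + ->; elim: p a => //= c p IH a /andP[/inversionU_opp ac /IH].
by move/connect_trans; apply; apply: connect1.
Qed.

Lemma closureU_lt a b : R a b -> rk a < rk b.
Proof. by case/andP => ne /connectU_le le; rewrite ltn_neqAle -rkE ne. Qed.

Lemma closureU_transitive : transitive R.
Proof.
move=> b a c Rab Rbc; have := closureU_lt Rab; have := closureU_lt Rbc.
case/andP: Rab => _ ab; case/andP: Rbc => _ bc bc' ab'.
by apply/andP; split; [rewrite rkE; lia | apply: connect_trans bc].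
Qed.

Lemma closureU_cotransitive a b c :
  rk a < rk c -> rk c < rk b -> R a b -> R a c || R c b.
Proof.
move=> ac cb /andP[_ ab]; suff : connect I a c || connect I c b.
  by case/orP => h; apply/orP; [left|right]; rewrite /R h andbT rkE; lia.
case/connectP: ab ac cb => p + ->; elim: p a => [|d p IH] a /=; first by lia.
case/andP=> Iad dp ac cb.
have db : connect I d (last d p) by apply/connectP; exists p.
case: (ltngtP (rk d) (rk c)) => [dc|cd|/rk_inj <-]; last by rewrite db orbT.
  have /orP[h|->] := IH _ dp dc cb; last by rewrite orbT.
  by rewrite (connect_trans (connect1 Iad) h).
have split w : inversion w a d -> inversion w a c || inversion w c d.
  by rewrite /inversion ac cd; lia.
have : I a c || I c d.
  by case/orP: Iad => /split /orP[]; rewrite /I => ->; rewrite ?orbT.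
case/orP => [/connect1->//|/connect1 h].
by rewrite (connect_trans h db) orbT.
Qed.

Lemma closureU_opp a b : R a b -> R (opp b) (opp a).
Proof.
case/andP=> ne /connectU_opp h; rewrite /R h andbT.
by rewrite (inj_eq (can_inj (@oppK n))) eq_sym.
Qed.

Lemma joinR_inversion :
  is_joinR (coxB n) u v (joinR (coxB n) u v) /\
  inversion (joinR (coxB n) u v) =2 R.
Proof.
have [w wR] := biclosed_inversion closureU_lt closureU_transitive
                 closureU_cotransitive closureU_opp.
have wI a b : I a b -> inversion w a b.
  move=> Iab; rewrite wR /R connect1 // andbT rkE.
  by have := inversionU_lt Iab; lia.
have jw : is_joinR (coxB n) u v w.
  rewrite /is_joinR !(weakR_cocycle (coxB_cocycle n)); apply/and3P; split.
  - by apply/inv_refl_sub => a b h; apply: wI; rewrite /I h.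
  - by apply/inv_refl_sub => a b h; apply: wI; rewrite /I h orbT.
  apply/forallP => z; rewrite !(weakR_cocycle (coxB_cocycle n)).
  apply/implyP => /andP[/inv_refl_sub uz /inv_refl_sub vz].
  apply/inv_refl_sub => a b; rewrite wR => /andP[ne /connectP[p + E]].
  elim: p a ne E => [|c p IH] a /=; first by move=> /eqP + E; case.
  move=> _ E /andP[Iac cp]; have zac : inversion z a c.
    by case/orP: Iac => [/uz|/vz].
  have [cb|cb] := eqVneq c b; first by rewrite -cb.
  exact: inversion_transitive zac (IH c cb E cp).
suff -> : joinR (coxB n) u v = w by [].
rewrite /joinR; case: pickP => [w' jw'|/(_ w)]; last by rewrite jw.
exact: is_joinR_uniq jw' jw.
Qed.

(** * Bruhat paths labelled by the inversions of two signed permutations *)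

Local Notation A := (inv_refl u :|: inv_refl v).

(** Existence of a Bruhat path with labels in [A] from [y^-1] to [z^-1].  It is
    convenient to follow the inverses, on which a label [refl c d] acts by
    exchanging the values at [c] and [d] (and at [-c] and [-d]). *)
Definition ascends y z := connect (bruhat_step (coxB n) A) y^-1 z^-1.

Lemma ascends_trans y z x : ascends y z -> ascends z x -> ascends y x.
Proof. exact: connect_trans. Qed.

Lemma ascends1 y a b :
  I a b -> rk (y a) < rk (y b) -> ascends y (y * refl a b).
Proof.
move=> Iab lt; have ab := inversionU_lt Iab.
rewrite /ascends invMg refl_inv.
apply/connect1/(bruhat_step_reflM (coxB_cocycle n)).
- by rewrite subUset !(cocycle_sub_reflections (coxB_cocycle n)).
- by rewrite inE !mem_inv_refl_inversion.
by rewrite mem_inv_refl // invgK -leqNgt ltnW.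
Qed.

Lemma refl_conj_chain a b e : rk a < rk b -> rk b < rk e -> rk (opp a) < rk e ->
  refl a b * refl b e * refl a b = refl a e.
Proof.
move=> ab be ae; rewrite refl_conjM reflR refl_out //.
all: move: ae; rewrite ?rk_opp; have := rk_lt e; lia.
Qed.

(** A chain of inversions [b0 < b1 < .. < e] gives a path to [refl b0 e], with
    palindromic labels [(b0 b1), (b1 b2), .., (b1 b2), (b0 b1)]: the value [a],
    initially at [b0], is moved up to [e], and then the value [e] down to [b0].
    The hypothesis [-a < e] makes [e] larger than all the other values met.  For
    the induction, where [b0] increases and [a] is fixed, the places of the chain
    above [-a] hold their own value, and those up to [-a], which may have been
    visited up to sign, hold values between [a] and [-a]. *)
Lemma ascends_chain a b0 b1 p y : let e := last b1 p in
    path I b0 (b1 :: p) -> rk a <= rk b0 -> rk (opp a) < rk e -> y b0 = a ->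
    (forall c, c \in b1 :: p ->
       if rk c <= rk (opp a) then rk a <= rk (y c) <= rk (opp a)
       else y c == c) ->
  ascends y (y * refl b0 e).
Proof.
elim: p b0 b1 y => [|b2 p IH] b0 b1 y e.
  rewrite /e /= andbT => I01 ab0 ae y0 /(_ b1).
  rewrite inE eqxx leqNgt ae => /(_ isT)/eqP y1.
  apply: ascends1 => //; rewrite y0 y1.
  by apply: leq_ltn_trans (inversionU_lt I01).
move=> bp ab0 ae y0 yp.
have [I01 p12] : I b0 b1 /\ path I b1 (b2 :: p) by apply/andP.
have b01 := inversionU_lt I01.
have E : e = last b2 p by [].
have b1e : rk b1 < rk e by apply: pathU_lt p12 _; rewrite E mem_last.
have yb1 := yp b1; rewrite inE eqxx in yb1; have {}yb1 := yb1 isT.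
have ay1 : rk a < rk (y b1).
  have : rk (y b1) != rk a by rewrite -y0 -rkE (inj_eq (@sp_inj _ _)) rkE; lia.
  by move: yb1; case: ifP => [_|_ /eqP->]; lia.
have ye : y e = e.
  by have := yp e; rewrite inE E mem_last orbT -E leqNgt ae => /(_ isT)/eqP.
apply: (@ascends_trans _ (y * refl b0 b1)).
  by apply: ascends1; rewrite ?y0.
apply: (@ascends_trans _ (y * refl b0 b1 * refl b1 e)).
  apply: IH => //; first by lia.
    by rewrite spM reflR.
  move=> c cp; rewrite spM.
  have b1c := pathU_lt p12 cp.
  have := yp c; rewrite inE cp orbT => /(_ isT).
  case: ifP => [ca yc|ca /eqP yc]; last first.
    by rewrite refl_out ?yc // ?rk_opp; move: ca; rewrite ?rk_opp; have := rk_lt c; lia.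
  have {}yb1 : rk a <= rk (y b1) <= rk (opp a).
    by move: yb1; rewrite (leq_trans (ltnW b1c) ca).
  rewrite reflE /refl_fun.
  case: eqP => [cE|_]; first by rewrite cE in b1c; lia.
  case: eqP => [cE|_]; first by rewrite cE in b1c; lia.
  case: eqP => [_|_].
    move: yb1; rewrite sp_opp !rk_opp.
    by have := rk_lt (y b1); have := rk_lt a; lia.
  case: eqP => // _; rewrite sp_opp y0 leqnn andbT; lia.
rewrite -(refl_conj_chain b01 b1e) ?mulgA; last first.
  by move: ae; rewrite !rk_opp; lia.
apply: ascends1 => //; rewrite !spM reflL.
have -> : refl b0 b1 e = e.
  by apply: refl_out; move: ae; rewrite ?rk_opp; have := rk_lt e; lia.
rewrite ye; have [b0E|nb] := eqVneq b0 (opp b1).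
  have -> : refl b1 e b0 = opp e by rewrite b0E reflE refl_fun_opp -reflE reflL.
  rewrite !sp_opp (_ : refl b0 b1 e = e); last first.
    by apply: refl_out; move: ae; rewrite ?rk_opp; have := rk_lt e; lia.
  by rewrite ye; move: b01; rewrite b0E !rk_opp; have := rk_lt e; lia.
rewrite (refl_out (a := b1)) ?reflL -?rkE //; first last.
- by rewrite rkE; move: ae; rewrite !rk_opp; have := rk_lt e; lia.
- by rewrite rkE; lia.
- by rewrite rkE; lia.
by move: yb1; case: ifP => [_|_ /eqP->]; lia.
Qed.

Lemma rpathU_lt c s d : path (fun a => I^~ a) c s -> d \in s -> rk d < rk c.
Proof.
elim: s c => //= e s IH c /andP[/inversionU_lt ec /IH h]; rewrite inE.
by case/orP => [/eqP->//|/h de]; apply: ltn_trans ec.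
Qed.

Lemma rpathU_last_le c s d :
  path (fun a => I^~ a) c s -> d \in c :: s -> rk (last c s) <= rk d.
Proof.
elim: s c => [|e s IH] c; first by rewrite inE => _ /eqP->.
move=> ecs; rewrite inE => /orP[/eqP->|].
  exact/ltnW/(rpathU_lt ecs)/(mem_last e s).
by apply: IH; case/andP: ecs.
Qed.

(** A chain of inversions, listed downwards from [c] to [l] with [(-l, l)] an
    inversion, gives a path to [refl (-c) c], whose labels follow the chain down,
    change the sign of [l], and follow the chain back up. *)
Lemma ascends_sign c s y : path (fun a => I^~ a) c s ->
    I (opp (last c s)) (last c s) -> rk (opp (y c)) < rk (y c) ->
    (forall d, d \in s -> rk (opp (y c)) < rk (y d) < rk (y c)) ->
  ascends y (y * refl (opp c) c).
Proof.
elim: s c y => [|d s IH] c y.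
  by move=> _ Ic yc _; apply: ascends1 => //; rewrite sp_opp.
move=> cs Il yc ys.
have [Idc ds] : I d c /\ path (fun a => I^~ a) d s by apply/andP.
have pos (x : pm n) : x \in d :: s -> rk (opp x) < rk x.
  move=> xs; have := rpathU_last_le ds xs; have := inversionU_lt Il.
  by rewrite /= !rk_opp; have := rk_lt (last d s); lia.
have dc := inversionU_lt Idc; have d0 := pos d (mem_head _ _).
have yd := ys d (mem_head _ _).
have y1s (x : pm n) : x \in s -> (y * refl d c) x = y x.
  move=> xs; have := pos x; rewrite inE xs orbT => /(_ isT).
  have := rpathU_lt ds xs; have := rk_lt c; move: d0; rewrite spM !rk_opp => *.
  by rewrite refl_out ?rk_opp //; lia.
apply: (@ascends_trans _ (y * refl d c)); first by apply: ascends1; lia.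
apply: (@ascends_trans _ (y * refl d c * refl (opp d) d)).
  apply: IH => //; rewrite spM reflL // => x xs.
  by rewrite y1s //; apply: ys; rewrite inE xs orbT.
have <- : refl d c * refl (opp d) d * refl d c = refl (opp c) c.
  by rewrite refl_conjM sp_opp reflL.
rewrite !mulgA; apply: ascends1 => //; rewrite !spM reflR sp_opp reflL sp_opp.
suff -> : refl (opp d) d c = c by rewrite reflR; case/andP: yd.
move: d0; rewrite rk_opp => d0; apply: refl_out; rewrite ?rk_opp;
  have := rk_lt c; lia.
Qed.

(** A chain from [-c] to [c] has a step from a negative [a] to a positive [b].  If
    [(a, b)] is an inversion of [w], so is [(-b, b)] or [(a, -a)]: otherwise
    [w^-1 b] is positive and [w^-1 a] negative.  The end of the chain joins [b] to
    [c], and the negation of its beginning joins [-a] to [c]. *)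
Lemma connectU_sign c : connect I (opp c) c -> rk (opp c) < rk c ->
  exists2 l, I (opp l) l & connect I l c.
Proof.
move=> cc c0; have : connect I (opp (opp c)) c by rewrite oppK.
have : rk (opp c) < rk (opp (opp c)) by rewrite oppK.
case/connectP: cc => p; elim: p (opp c) => [|b p IH] a /=.
  by move=> _ E a0; move: c0; rewrite E !rk_opp in a0 *; lia.
case/andP=> Iab bp E a0 oac.
have [b0|b0] := ltnP (rk b) (rk (opp b)).
  apply: IH E b0 _ => //; apply: connect_trans oac.
  exact/connect1/inversionU_opp.
have bc : connect I b c by apply/connectP; exists p.
have : I (opp b) b || I a (opp a).
  have ab w : inversion w a b -> inversion w (opp b) b || inversion w a (opp a).
    move: b0 a0; rewrite /inversion !sp_opp !rk_opp.
    have := rk_lt (w^-1 a); have := rk_lt (w^-1 b).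
    by have := rk_lt a; have := rk_lt b; lia.
  by case/orP: Iab => /ab /orP[]; rewrite /I => ->; rewrite ?orbT.
case/orP => [|Ia]; first by exists b.
by exists (opp a); rewrite ?oppK.
Qed.

Lemma ascends_closure a b : R a b -> ascends 1 (refl a b).
Proof.
have chain c d : connect I c d -> rk c < rk d -> rk (opp c) < rk d ->
    ascends 1 (refl c d).
  case/connectP => -[|e p] cp ->; first by rewrite ltnn.
  move=> _ cd; rewrite -[refl _ _]mul1g.
  apply: (@ascends_chain c c e p 1); rewrite ?sp1 // => x xp; rewrite sp1 eqxx.
  by case: ifP => // ->; rewrite ltnW // (pathU_lt cp).
move=> Rab; have ab := closureU_lt Rab; case/andP: Rab => _ cab.
have [ba|ba|/rk_inj bE] := ltngtP (rk b) (rk (opp a)); last first.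
- move: ab cab; rewrite -(oppK a) -{}bE => b0 cb.
  have [l Il /connectP[p lp bl]] := connectU_sign cb b0.
  pose s := rev (belast l p).
  have sl : last b s = l.
    by rewrite /s bl; case: (p) => //= e q; rewrite rev_cons last_rcons.
  have bs : path (fun a => I^~ a) b s by rewrite bl rev_path.
  rewrite -[refl _ _]mul1g; apply: (ascends_sign bs); rewrite ?sl ?sp1 // => x xs.
  have := rpathU_lt bs xs; have := @rpathU_last_le _ _ x bs.
  rewrite sp1 inE xs orbT sl => /(_ isT); have := inversionU_lt Il.
  by move: b0; rewrite !rk_opp; lia.
- exact: chain.
rewrite -refl_opp; apply: chain; rewrite ?oppK //; first exact: connectU_opp.
by move: ab; rewrite !rk_opp; have := rk_lt b; lia.
Qed.

Lemma left_refl_joinR :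
  left_refl (coxB n) (joinR (coxB n) u v)
    = bruhat_preclosure (coxB n)
        (left_refl (coxB n) u :|: left_refl (coxB n) v).
Proof.
have [/and3P[uw vw _] wR] := joinR_inversion.
rewrite !(weakR_cocycle (coxB_cocycle n)) in uw vw.
rewrite !(left_refl_cocycle (coxB_cocycle n)).
apply/eqP; rewrite eqEsubset (bruhat_preclosure_sub (coxB_cocycle n)) ?andbT;
  last by rewrite subUset uw.
apply/subsetP => t tw; rewrite inE.
rewrite (subsetP (cocycle_sub_reflections (coxB_cocycle n) _) _ tw) /=.
case/inv_reflP: tw => -[a b] /=; rewrite wR => /ascends_closure + ->.
by rewrite /ascends invg1 refl_inv.
Qed.

End UnionClosure.
End Join.

Theorem mainTheorem2 (n : nat) (n_ge1 : 1 <= n) (u v : signed_perm n) :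
  is_joinR (coxB n) u v (joinR (coxB n) u v) /\
  left_refl (coxB n) (joinR (coxB n) u v)
    = bruhat_preclosure (coxB n)
        (left_refl (coxB n) u :|: left_refl (coxB n) v).
Proof. by split; [case: (joinR_inversion u v) | apply: left_refl_joinR]. Qed.
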